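(* Let $\Phi\in\mathcal{E}(I)$ be increasing, let $f:I\to\mathbb{R}$ be a $\Phi$-affine function and let $\varphi:I\to\mathbb{R}$ be an absolute $\Phi$-slope function for $f$. Then $\varphi$ is $\Phi^*$-H\''older, where $\Phi^*:[0,\ell(I))\to[0,\infty)$ is defined by $$\Phi^*(t):=\begin{cases}2\dfrac{\Phi(t)}{t} & \text{if } 0<t<\ell(I),\\ 0 & \text{if } t=0.\end{cases}$$
   Context: $I\subseteq\mathbb{R}$ is a nonempty open interval and $\ell(I)\in(0,\infty]$ is its length. $\mathcal{E}(I)$ is the set of all functions $\Phi:[0,\ell(I))\to[0,\infty)$ (called error functions). ''Increasing'' is meant in the non-strict sense. For $\Phi\in\mathcal{E}(I)$, a function $f:I\to\mathbb{R}$ is called $\Phi$-affine if for all $x,y\in I$ and $t\in[0,1]$, $$|f(tx+(1-t)y)-tf(x)-(1-t)f(y)|\leq t\Phi((1-t)|x-y|)+(1-t)\Phi(t|x-y|).$$ A function $\varphi:I\to\mathbb{R}$ is an absolute $\Phi$-slope function for $f$ if $|f(u)-f(x)-(u-x)\varphi(u)|\leq\Phi(|u-x|)$ for all $x,u\in I$. For $\Psi\in\mathcal{E}(I)$, a function $g:I\to\mathbb{R}$ is $\Psi$-H\''older if $|g(x)-g(y)|\leq\Psi(|x-y|)$ for all $x,y\in I$. *)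

(* Defs.v *)
From HB Require Import structures.
From mathcomp Require Import all_boot all_order all_algebra.
From mathcomp Require Import all_classical all_reals all_analysis.

Set Implicit Arguments.
Unset Strict Implicit.
Unset Printing Implicit Defensive.

Import Order.TTheory GRing.Theory Num.Theory.
Import numFieldNormedType.Exports.

Local Open Scope classical_set_scope.
Local Open Scope ring_scope.

Definition length_itv (R : realType) (I : set R) : \bar R :=
  (ereal_sup (EFin @` I) - ereal_inf (EFin @` I))%E.

Definition error_dom (R : realType) (I : set R) : set R :=
  [set t | 0 <= t /\ (t%:E < length_itv I)%E].

(* {fun A >-> B}: total functions R -> R mapping A into B; values outside A
   play no role below, where all arguments lie in [0, l(I)). *)
Definition error_function (R : realType) (I : set R) :=
  {fun error_dom I >-> [set y : R | 0 <= y]}.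

Section Notions.
Context (R : realType) (I : set R).

Definition error_increasing (Phi : error_function I) : Prop :=
  {in error_dom I &, {homo Phi : s t / s <= t}}.

Definition error_affine (Phi : error_function I) (f : R -> R) : Prop :=
  forall x y t : R, I x -> I y -> 0 <= t <= 1 ->
    `|f (t * x + (1 - t) * y) - t * f x - (1 - t) * f y| <=
      t * Phi ((1 - t) * `|x - y|) + (1 - t) * Phi (t * `|x - y|).

Definition absolute_slope (Phi : error_function I) (f phi : R -> R) : Prop :=
  forall x u : R, I x -> I u ->
    `|f u - f x - (u - x) * phi u| <= Phi `|u - x|.

Definition error_holder (Psi : error_function I) (g : R -> R) : Prop :=
  forall x y : R, I x -> I y -> `|g x - g y| <= Psi `|x - y|.

Definition error_star (Phi : error_function I) (t : R) : R :=
  if 0 < t then 2 * (Phi t / t) else 0.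

Lemma error_star_fun (Phi : error_function I) :
  set_fun (error_dom I) [set y : R | 0 <= y] (error_star Phi).
Proof.
move=> t It /=; rewrite /error_star; case: ifP => // t0.
by rewrite mulr_ge0// divr_ge0 ?(ltW t0)//; exact: (@funS _ _ _ _ Phi).
Qed.

HB.instance Definition _ (Phi : error_function I) :=
  isFun.Build R R (error_dom I) [set y : R | 0 <= y] (error_star Phi)
    (@error_star_fun Phi).

End Notions.

(* Main.v *)
Require Import Defs.
From HB Require Import structures.
From mathcomp Require Import all_boot all_order all_algebra.
From mathcomp Require Import all_classical all_reals all_analysis.
From mathcomp Require Import ring.

(** The slope inequality may be used in both directions between two points x
    and y: with base point x and slope phi x, and with base point y and slope
    phi y. The increments of f in the two estimates are opposite, so adding
    the estimates eliminates f and leaves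
    |x - y| |phi x - phi y| <= 2 Phi |x - y|.
    Dividing by |x - y| when x != y gives the modulus; when x = y both sides
    vanish. *)

Set Implicit Arguments.
Unset Strict Implicit.
Unset Printing Implicit Defensive.

Import Order.TTheory GRing.Theory Num.Theory.
Import numFieldNormedType.Exports.

Local Open Scope classical_set_scope.
Local Open Scope ring_scope.

Theorem proposition3p4 (R : realType) (I : set R)
    (I_itv : is_interval I) (I_open : open I) (I_neq0 : I !=set0)
    (Phi : error_function I) (f phi : R -> R) :
  error_increasing Phi -> error_affine Phi f -> absolute_slope Phi f phi ->
  error_holder (error_star Phi) phi.
Proof.
move=> _ _ slope_phi x y Ix Iy; rewrite /= /error_star normr_gt0 subr_eq0.
have [->|xy /=] := eqVneq x y; first by rewrite subrr normr0.
have h_gt0 : 0 < `|x - y| by rewrite normr_gt0 subr_eq0.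
rewrite mulrA ler_pdivlMr // -normrM.
(* the values of f cancel in the sum of the two slope errors *)
have -> : (phi x - phi y) * (x - y) =
    - ((f x - f y - (x - y) * phi x) + (f y - f x - (y - x) * phi y)).
  by ring.
rewrite normrN (le_trans (ler_normD _ _)) // mulr_natl mulr2n lerD //.
  exact: slope_phi.
by rewrite [`|x - y|]distrC; exact: slope_phi.
Qed.
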